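(* Let $d\ge1$ and $0<\mu\le L$. There exist a $\mu$-strongly convex function $f:\mathbb R^d\to\mathbb R$ with $L$-Lipschitz continuous gradient, a closed convex nonempty set $\mathcal X\subseteq\mathbb R^d$, and a constant $b>0$ such that the following holds, where $x^*$ is the unique minimizer of $f$ over $\mathcal X$. For every $\eta>0$, every $x[0]\in\mathcal X\setminus\{x^*\}$ (this set being nonempty), and every real number $c(\eta)$ such that the centralized projected gradient iterates $$x[k+1]=\Pi_{\mathcal X}\big(x[k]-\eta\nabla f(x[k])\big),\qquad k\ge0,$$ satisfy $$\|x[k+1]-x[k]\|\le c(\eta)\,\|x[k]-x^*\|\quad\text{for all }k\ge0,$$ one has $c(\eta)\ge b$.
   Context: $\|\cdot\|$ is the Euclidean norm on $\mathbb R^d$ and $\Pi_{\mathcal X}(x)=\arg\min_{z\in\mathcal X}\|x-z\|$. A differentiable $f$ is $\mu$-strongly convex if $\langle\nabla f(x)-\nabla f(y),x-y\rangle\ge\mu\|x-y\|^2$ for all $x,y$. *)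

(* Defs.v *)
(* MathComp / MathComp-Analysis *)
From HB Require Import structures.
From mathcomp Require Import all_boot all_order all_algebra.
From mathcomp Require Import all_classical all_reals all_analysis.

Set Implicit Arguments.
Unset Strict Implicit.
Unset Printing Implicit Defensive.

Import Order.TTheory GRing.Theory Num.Theory.
Import numFieldNormedType.Exports.

Local Open Scope classical_set_scope.
Local Open Scope ring_scope.

Definition dotp (R : realType) (d : nat) (x y : 'rV[R]_d) : R :=
  \sum_(i < d) x 0 i * y 0 i.

(* MathComp-Analysis equips 'rV[R]_d with the max norm, hence a separate
   Euclidean norm; both induce the same topology, so that the library's [closed]
   and [differentiable] are the usual notions on R^d. *)
Definition enorm (R : realType) (d : nat) (x : 'rV[R]_d) : R :=
  Num.sqrt (dotp x x).

Definition grad (R : realType) (d : nat) (f : 'rV[R]_d -> R) (x : 'rV[R]_d) :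
    'rV[R]_d :=
  \row_(i < d) 'D_(delta_mx 0 i) f x.

Definition strongly_convex (R : realType) (d : nat) (mu : R)
    (f : 'rV[R]_d -> R) : Prop :=
  (forall x, differentiable f x) /\
  (forall x y, mu * enorm (x - y) ^+ 2 <= dotp (grad f x - grad f y) (x - y)).

Definition lipschitz_grad (R : realType) (d : nat) (L : R)
    (f : 'rV[R]_d -> R) : Prop :=
  forall x y, enorm (grad f x - grad f y) <= L * enorm (x - y).

Definition argmin (R : realType) (T : Type) (X : set T) (h : T -> R) : set T :=
  [set z | X z /\ forall y, X y -> h z <= h y].

(* [xget 0 A] is an element of A when A is nonempty. For X closed, convex and
   nonempty this argmin is a singleton and the default value 0 plays no role. *)
Definition proj_on (R : realType) (d : nat) (X : set 'rV[R]_d) (x : 'rV[R]_d) :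
    'rV[R]_d :=
  xget 0 (argmin X (fun z => enorm (x - z))).

(* Main.v *)
Require Import Defs.
From HB Require Import structures.
From mathcomp Require Import all_boot all_order all_algebra.
From mathcomp Require Import all_classical all_reals all_analysis.
From mathcomp Require Import ring lra.

(** The constant cannot tend to 0 with the step size when the iterates
    reach the minimizer in finitely many steps: on the last step before arrival
    the displacement is exactly the distance to the minimizer, so the ratio of
    the two is 1, whatever the step size.

    Finite arrival is forced by a constraint whose multiplier at the minimizer
    is nonzero.  Fix a unit vector [e], let [X] be the half-line of nonnegative
    multiples of [e], and let [f x = mu/2 |x|^2 + <e, x>].  Its gradient
    [mu x + e] is [mu]-strongly monotone and [mu]-Lipschitz, and [f] restricted
    to [X] is [t |-> mu/2 t^2 + t], minimized at [0], where the gradient is [e]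
    and not [0].  A projected gradient step maps [t e] to
    [max (t - eta (mu t + 1)) 0 e] ([proj_ray], [quad_step]): the coordinate
    drops by at least [eta] until it is truncated to [0], which by the
    archimedean property happens after finitely many steps
    ([descent_reaches_npos]).  The bound therefore holds with [b = 1]. *)

Import Order.TTheory GRing.Theory Num.Theory.
Import numFieldNormedType.Exports.
Local Open Scope classical_set_scope.
Local Open Scope ring_scope.

(** * Euclidean calculus *)

Section EuclideanSpace.
Context {R : realType} {d : nat}.
Implicit Types (x y z e : 'rV[R]_d) (s t k : R).

Lemma dotpC x y : dotp x y = dotp y x.
Proof. by apply: eq_bigr => i _; rewrite mulrC. Qed.

Lemma dotpDr x y z : dotp x (y + z) = dotp x y + dotp x z.
Proof. by rewrite -big_split; apply: eq_bigr => i _; rewrite mxE mulrDr. Qed.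

Lemma dotpZr k x y : dotp x (k *: y) = k * dotp x y.
Proof. by rewrite mulr_sumr; apply: eq_bigr => i _; rewrite mxE mulrCA. Qed.

Lemma dotp0 x : dotp x 0 = 0.
Proof. by rewrite -(scale0r 0) dotpZr mul0r. Qed.

Lemma dotpDl x y z : dotp (y + z) x = dotp y x + dotp z x.
Proof. by rewrite dotpC dotpDr !(dotpC x). Qed.

Lemma dotpZl k x y : dotp (k *: y) x = k * dotp y x.
Proof. by rewrite dotpC dotpZr dotpC. Qed.

Lemma dotp_ge0 x : 0 <= dotp x x.
Proof. by apply: sumr_ge0 => i _; rewrite -expr2 sqr_ge0. Qed.

Lemma dotp_eq0 x : dotp x x = 0 -> x = 0.
Proof.
move/eqP; rewrite psumr_eq0; last by move=> i _; rewrite -expr2 sqr_ge0.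
move/allP => xx0; apply/rowP => i; rewrite mxE.
by have /(_ (mem_index_enum i)) := xx0 i; rewrite mulf_eq0 orbb => /eqP.
Qed.

Lemma dotp_delta x i : dotp x (delta_mx 0 i) = x 0 i.
Proof.
rewrite /dotp (bigD1 i)//= big1 ?addr0 ?mxE ?eqxx ?mulr1// => j ji.
by rewrite mxE (negbTE ji) andbF mulr0.
Qed.

Lemma sqr_enorm x : enorm x ^+ 2 = dotp x x.
Proof. by rewrite sqr_sqrtr// dotp_ge0. Qed.

Lemma enormZ k x : enorm (k *: x) = `|k| * enorm x.
Proof.
by rewrite /enorm dotpZl dotpZr mulrA -expr2 sqrtrM ?sqr_ge0// sqrtr_sqr.
Qed.

Lemma enormN x : enorm (- x) = enorm x.
Proof. by rewrite -scaleN1r enormZ normrN normr1 mul1r. Qed.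

Lemma enorm_gt0 x : x <> 0 -> 0 < enorm x.
Proof.
move=> x0; rewrite sqrtr_gt0 lt_neqAle dotp_ge0 andbT eq_sym.
by apply/eqP => /dotp_eq0.
Qed.

Lemma is_derive_coord i x v : is_derive x v (fun y : 'rV[R]_d => y 0 i) (v 0 i).
Proof.
pose c (y : 'rV[R]_d) : R := y 0 i.
have clin : linear c by move=> k y z; rewrite /c !mxE.
pose cM := GRing.isLinear.Build _ _ _ _ _ clin.
pose cL : {linear 'rV[R]_d -> R} := HB.pack c cM.
have cdiff : differentiable cL x by exact: differentiable_coord.
split; first exact: diff_derivable.
by rewrite (deriveE _ cdiff) (@diff_lin _ _ _ cL)//; exact: coord_continuous.
Qed.

Lemma differentiable_dotp e x : differentiable (dotp e) x.
Proof.
have -> : dotp e = \sum_(i < d) (e 0 i *: (fun y : 'rV[R]_d => y 0 i)).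
  by rewrite fct_sumE; apply/funext => y.
apply: differentiable_sum => i; apply: differentiableZ.
exact: differentiable_coord.
Qed.

Lemma derive_dotp e x v : 'D_v (dotp e) x = dotp e v.
Proof.
have -> : dotp e = \sum_(i < d) (e 0 i \*: (fun y : 'rV[R]_d => y 0 i)).
  by rewrite fct_sumE; apply/funext => y.
have ? i := is_deriveZ (e 0 i) (is_derive_coord i x v).
by rewrite derive_val fct_sumE.
Qed.

Lemma sqdotpE :
  (fun x : 'rV[R]_d => dotp x x) =
  \sum_(i < d) ((fun x : 'rV[R]_d => x 0 i) * (fun x : 'rV[R]_d => x 0 i)).
Proof. by rewrite fct_sumE; apply/funext => x. Qed.

Lemma differentiable_sqdotp x :
  differentiable (fun y : 'rV[R]_d => dotp y y) x.
Proof.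
rewrite sqdotpE; apply: differentiable_sum => i.
by apply: differentiableM; exact: differentiable_coord.
Qed.

Lemma derive_sqdotp x v :
  'D_v (fun y : 'rV[R]_d => dotp y y) x = 2 * dotp x v.
Proof.
have ? i := is_deriveM (is_derive_coord i x v) (is_derive_coord i x v).
rewrite sqdotpE derive_val mulr_sumr; apply: eq_bigr => i _.
by rewrite /GRing.scale/=; ring.
Qed.

(** * A strongly convex quadratic *)

Definition quad (mu : R) e x : R := mu / 2 * dotp x x + dotp e x.

Lemma differentiable_quad mu e x : differentiable (quad mu e) x.
Proof.
apply: differentiableD; last exact: differentiable_dotp.
by apply: (@differentiableZ _ _ _ _ (mu / 2)); exact: differentiable_sqdotp.
Qed.

Lemma grad_quad mu e x : grad (quad mu e) x = mu *: x + e.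
Proof.
apply/rowP => i; rewrite !mxE.
have -> : quad mu e = (mu / 2) \*: (fun y : 'rV[R]_d => dotp y y) + dotp e by [].
have d2 : derivable (fun y : 'rV[R]_d => dotp y y) x (delta_mx 0 i).
  exact/diff_derivable/differentiable_sqdotp.
have d1 : derivable (dotp e) x (delta_mx 0 i).
  exact/diff_derivable/differentiable_dotp.
rewrite deriveD//; last exact: derivableZ.
rewrite deriveZ// derive_sqdotp derive_dotp !dotp_delta.
by rewrite /GRing.scale/=; field.
Qed.

Lemma gradB_quad mu e x y :
  grad (quad mu e) x - grad (quad mu e) y = mu *: (x - y).
Proof. by rewrite !grad_quad scalerBr opprD addrACA subrr addr0. Qed.

Lemma strongly_convex_quad mu e : strongly_convex mu (quad mu e).
Proof.
split=> [x|x y]; first exact: differentiable_quad.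
by rewrite gradB_quad dotpZl sqr_enorm.
Qed.

Lemma lipschitz_grad_quad mu L e :
  0 < mu -> mu <= L -> lipschitz_grad L (quad mu e).
Proof.
move=> mu0 muL x y; rewrite gradB_quad enormZ gtr0_norm//.
by rewrite ler_wpM2r// sqrtr_ge0.
Qed.

(** * The half-line spanned by a unit vector *)

Definition ray e : set 'rV[R]_d := [set t *: e | t in [set t | 0 <= t]].

Lemma ray0 e : ray e 0.
Proof. by exists 0; rewrite ?scale0r//=. Qed.

Lemma convex_ray e : convex_set (ray e).
Proof.
move=> _ _ p /set_mem[s /= s0 <-] /set_mem[t /= t0 <-]; apply/mem_set.
exists (p%:num * s + (1 - p%:num) * t) => /=.
  by rewrite addr_ge0// mulr_ge0// subr_ge0.
by rewrite scalerDl -!scalerA.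
Qed.

Context {e : 'rV[R]_d} (e1 : dotp e e = 1).

Lemma enorm_unit : enorm e = 1.
Proof. by rewrite /enorm e1 sqrtr1. Qed.

Lemma dotp_unit t : dotp e (t *: e) = t.
Proof. by rewrite dotpZr e1 mulr1. Qed.

(** [|x|^2 - <e, x>^2] is the squared distance from [x] to the line [R e], so
    the half-line is cut out by two continuous scalar conditions. *)
Lemma closed_ray : closed (ray e).
Proof.
have -> : ray e = [set x | 0 <= dotp e x] `&`
                  [set x | dotp x x - dotp e x * dotp e x = 0].
  apply/seteqP; split=> [_ [t /= t0 <-]|x [/= x0 xE]].
    by split=> /=; rewrite dotp_unit// dotpZl dotp_unit subrr.
  exists (dotp e x) => //; apply/esym/eqP; rewrite -subr_eq0; apply/eqP.
  apply: dotp_eq0; rewrite -xE -scaleNr !dotpDl !dotpDr !dotpZl !dotpZr e1.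
  by rewrite (dotpC x e); ring.
have ctse : continuous (dotp e).
  by move=> x; exact/differentiable_continuous/differentiable_dotp.
have cts2 : continuous (fun x : 'rV[R]_d => dotp x x).
  by move=> x; exact/differentiable_continuous/differentiable_sqdotp.
apply: closedI.
  by apply: (preimage_closed (f := dotp e)) (@closed_ge _ 0) => x _; exact: ctse.
apply: (preimage_closed (f := fun x => dotp x x - dotp e x * dotp e x))
  (@closed_eq _ 0) => x _.
exact: (cvgB (cts2 x) (cvgM (ctse x) (ctse x))).
Qed.

Lemma ray_coord x : ray e x -> 0 <= dotp e x /\ x = dotp e x *: e.
Proof. by move=> [t /= t0 <-]; rewrite dotp_unit. Qed.

Lemma proj_ray s : proj_on (ray e) (s *: e) = Num.max s 0 *: e.
Proof.
have distE t : enorm (s *: e - t *: e) = `|s - t|.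
  by rewrite -scalerBl enormZ enorm_unit mulr1.
have rayp : ray e (Num.max s 0 *: e).
  by exists (Num.max s 0) => //=; rewrite le_max lexx orbT.
apply: xget_unique => [|_ [[t /= t0 <-] /(_ _ rayp)]].
  split=> // _ [t /= t0 <-]; rewrite !distE.
  case: (leP s 0) => [s0|s0]; last by rewrite subrr normr0.
  by rewrite subr0 !ler0_norm; lra.
rewrite !distE => le_dist.
congr (_ *: _); move: le_dist; case: (leP s 0) => s0.
  by rewrite subr0 !ler0_norm; lra.
by rewrite subrr normr0 normr_le0 subr_eq0 => /eqP.
Qed.

Lemma quad_ray mu t : quad mu e (t *: e) = mu / 2 * t ^+ 2 + t.
Proof. by rewrite /quad dotp_unit dotpZl dotp_unit expr2. Qed.

Lemma argmin_quad_ray mu : 0 < mu -> argmin (ray e) (quad mu e) = [set 0].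
Proof.
move=> mu0; have q0 : quad mu e 0 = 0.
  by rewrite /quad !dotp0 mulr0 addr0.
have q_ge t : t <= quad mu e (t *: e).
  by rewrite quad_ray lerDr mulr_ge0 ?sqr_ge0//; lra.
apply/seteqP; split=> [_ [[t /= t0 <-]]|_ ->] /=.
  move=> /(_ 0 (ray0 e)); rewrite q0 => /(le_trans (q_ge t)) t_le0.
  by rewrite (_ : t = 0) ?scale0r//; apply/eqP; rewrite eq_le t_le0.
split=> [|_ [t /= t0 <-]]; first exact: ray0.
by rewrite q0 (le_trans t0).
Qed.

(** The step stays on the line [R e] because the gradient is a multiple of [e]
    at every point of the line; projecting is then truncation at [0]. *)
Lemma quad_step mu eta t :
  proj_on (ray e) (t *: e - eta *: grad (quad mu e) (t *: e)) =
  Num.max (t - eta * (mu * t + 1)) 0 *: e.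
Proof.
rewrite -proj_ray; congr (proj_on _ _).
by rewrite grad_quad scalerDr !scalerA scalerBl mulrDr mulr1 scalerDl mulrA.
Qed.

End EuclideanSpace.

(** * Finite arrival *)

(** As long as [s] is positive it stays below [s 0 - k delta], which is negative
    once [k] exceeds [s 0 / delta]. *)
Lemma descent_reaches_npos {R : archiRealFieldType} {s : nat -> R} {delta : R} :
  0 < delta -> 0 < s 0 ->
  (forall k, 0 < s k.+1 -> s k.+1 <= s k - delta) ->
  exists k, 0 < s k /\ s k.+1 <= 0.
Proof.
move=> delta0 s0 sdec; apply: contrapT => noarrival.
have spos k : 0 < s k.
  elim: k => // k IHk; rewrite ltNge; apply/negP => sk.
  by apply: noarrival; exists k.
have sle k : s k <= s 0 - delta *+ k.
  elim: k => [|k IHk]; first by rewrite mulr0n subr0.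
  apply: le_trans (sdec k (spos _)) _.
  by rewrite mulrSr opprD addrA lerB.
have := archi_boundP (ltW (divr_gt0 s0 delta0)).
rewrite ltr_pdivrMr// => bound_gt.
have := lt_le_trans (spos _) (sle (Num.bound (s 0 / delta))).
by rewrite subr_gt0 -mulr_natl ltNge (ltW bound_gt).
Qed.

Theorem lemma9 (R : realType) (d : nat) (mu L : R) (hd : (1 <= d)%N)
    (hmu : 0 < mu) (hmuL : mu <= L) :
  exists (f : 'rV[R]_d -> R) (X : set 'rV[R]_d) (b : R) (xs : 'rV[R]_d),
    strongly_convex mu f /\
    lipschitz_grad L f /\
    closed X /\
    convex_set X /\
    X !=set0 /\
    0 < b /\
    argmin X f = [set xs] /\
    X `\ xs !=set0 /\
    forall (eta : R) (x : nat -> 'rV[R]_d) (c : R),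
      0 < eta ->
      (X `\ xs) (x 0%N) ->
      (forall k : nat, x k.+1 = proj_on X (x k - eta *: grad f (x k))) ->
      (forall k : nat, enorm (x k.+1 - x k) <= c * enorm (x k - xs)) ->
      b <= c.
Proof.
have [e e1] : exists e : 'rV[R]_d, dotp e e = 1.
  by exists (delta_mx 0 (Ordinal hd)); rewrite dotp_delta mxE !eqxx.
exists (quad mu e), (ray e), 1, 0.
split; first exact: strongly_convex_quad.
split; first exact: lipschitz_grad_quad.
split; first exact: closed_ray.
split; first exact: convex_ray.
split; first by exists 0; exact: ray0.
split; first exact: ltr01.
split; first exact: argmin_quad_ray.
split.
  exists e; split=> /=; first by exists 1; rewrite ?scale1r//=.
  by move=> e0; have := oner_neq0 R; rewrite -e1 e0 dotp0 eqxx.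
move=> eta x c eta0 [x0ray x0N0] xS xc.
pose t k := dotp e (x k).
have tS k : x k = t k *: e ->
    x k.+1 = Num.max (t k - eta * (mu * t k + 1)) 0 *: e.
  by move=> xk; rewrite xS xk quad_step.
have xt k : 0 <= t k /\ x k = t k *: e.
  apply: ray_coord => //; elim: k => // k IHk.
  rewrite (tS _ (ray_coord e1 _ IHk).2).
  by eexists; last reflexivity; rewrite /= le_max lexx orbT.
have t0 : 0 < t 0%N.
  rewrite lt_neqAle (xt _).1 andbT; apply/eqP => t0.
  by apply: x0N0; rewrite /= (xt _).2 -t0 scale0r.
have tdec k : 0 < t k.+1 -> t k.+1 <= t k - eta.
  rewrite {1 2}/t (tS _ (xt k).2) dotp_unit// lt_max ltxx orbF => step_gt0.
  rewrite (max_idPl (ltW step_gt0)) lerB// ler_peMr ?(ltW eta0)//.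
  by rewrite lerDr mulr_ge0 ?(ltW hmu)// (xt k).1.
have [k [tk_gt0 tk1_le0]] := descent_reaches_npos eta0 t0 tdec.
have tk1 : t k.+1 = 0 by apply/eqP; rewrite eq_le tk1_le0 (xt _).1.
have xk0 : x k <> 0 by move=> xk0; move: tk_gt0; rewrite /t xk0 dotp0 ltxx.
(* The arrival step covers exactly the distance to the minimizer. *)
have := xc k; rewrite (xt k.+1).2 tk1 scale0r sub0r subr0 enormN.
by rewrite ler_pMl ?enorm_gt0.
Qed.
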